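(* The IDF property does not ascend to polynomial extensions in the class of GL-domains; that is, there exists an integral domain $D$ such that $D$ is a GL-domain and $D$ has the IDF property, but the polynomial ring $D[x]$ does not have the IDF property.
   Context: Let $D$ be an integral domain. A nonzero polynomial $f \in D[X]$ is called primitive over $D$ if the ideal $I_f$ of $D$ generated by the coefficients of $f$ is not contained in any proper principal ideal of $D$; equivalently, the only common divisors in $D$ of the coefficients of $f$ are the units of $D$. The domain $D$ is a GL-domain if the product of any two primitive polynomials over $D$ is again primitive over $D$. The domain $D$ has the IDF property (is an IDF-domain) if every nonzero element of $D$ is divisible by only finitely many irreducible elements of $D$ up to associates. *)

(* Defs.v *)
From mathcomp Require Import all_boot all_algebra.

Set Implicit Arguments.
Unset Strict Implicit.
Unset Printing Implicit Defensive.

Import GRing.Theory.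
Local Open Scope ring_scope.

Definition divides (R : idomainType) (a b : R) : Prop :=
  exists c : R, b = c * a.

Definition associates (R : idomainType) (a b : R) : Prop :=
  exists2 u : R, u \is a GRing.unit & b = u * a.

Definition irreducible_elt (R : idomainType) (p : R) : Prop :=
  [/\ p != 0, p \isn't a GRing.unit
    & forall a b : R, p = a * b ->
        a \is a GRing.unit \/ b \is a GRing.unit].

(* The list s may contain superfluous elements: it only has to meet every
   class of associates of irreducible divisors of a. *)
Definition IDF_domain (R : idomainType) : Prop :=
  forall a : R, a != 0 ->
    exists s : seq R,
      forall p : R, irreducible_elt p -> divides p a ->
        exists2 q : R, q \in s & associates q p.

Definition content_ideal (D : idomainType) (f : {poly D}) (x : D) : Prop :=
  exists c : nat -> D, x = \sum_(i < size f) c i * f`_i.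

Definition principal_ideal (D : idomainType) (a x : D) : Prop :=
  exists c : D, x = c * a.

Definition primitive_poly (D : idomainType) (f : {poly D}) : Prop :=
  f != 0 /\
  forall a : D, (exists y : D, ~ principal_ideal a y) ->
    ~ (forall x : D, content_ideal f x -> principal_ideal a x).

Definition GL_domain (D : idomainType) : Prop :=
  forall f g : {poly D},
    primitive_poly f -> primitive_poly g -> primitive_poly (f * g).

(* Main.v *)
Require Import Defs.
From HB Require Import structures.
From mathcomp Require Import all_boot all_algebra closed_field.
From mathcomp Require Import ring boolp.

(** Let [E] be an infinite field of characteristic 2, [m] the maximal ideal of
    the local ring of the affine plane over [E] at the origin, and [J] the set
    of the elements, in an algebraically closed field containing [E(X, Y)], some
    [2^n]-th power of which is in [m]. The ring is [D = F_2 + J], a local ring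
    with maximal ideal [J].

    - Every element of [J] is the square of an element of [J], so [D] has no
      irreducible elements at all, and is trivially an IDF-domain.

    - If [f * g] has a common nonunit divisor [a], then some power of [a] is
      divisible by a prime [q] of the local ring. The elements of [D] some
      [2^n]-th power of which is divisible by [q] form a prime ideal, which
      contains all coefficients of [f] or all those of [g]; a [2^n]-th root of
      [q], for [n] large, is then a common divisor of these in [D].

    - For [l] in [E] nonzero, the polynomials [l X + l Y z] are irreducible
      divisors of [X (X + Y z)] in [D[z]]. They are pairwise nonassociate,
      because the only element of [E] which is a unit of [D] is 1. *)

Set Implicit Arguments.
Unset Strict Implicit.
Unset Printing Implicit Defensive.

Import GRing.Theory Pdiv.Idomain.
Local Open Scope ring_scope.

(** * Subrings of a field as integral domains *)

Section Subdomain.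

Variables (K : fieldType) (S : subringClosed K).

Record subdomain := Subdomain {subdomain_val :> K; _ : subdomain_val \in S}.
HB.instance Definition _ := [isSub for subdomain_val].
HB.instance Definition _ := [Choice of subdomain by <:].
HB.instance Definition _ := [SubChoice_isSubComNzRing of subdomain by <:].

Definition subdomain_unit : pred subdomain :=
  fun x => (val x != 0) && ((val x)^-1 \in S).

(** The default [x] of [insubd] leaves nonunits fixed, as the convention on inverses demands. *)
Definition subdomain_inv (x : subdomain) : subdomain := insubd x (val x)^-1.

Lemma subdomain_mulVx : {in subdomain_unit, left_inverse 1 subdomain_inv *%R}.
Proof.
move=> x /andP[x0 xS]; apply: val_inj.
by rewrite rmorphM rmorph1 /= insubdK // mulVf.
Qed.

Lemma subdomain_unitP x y : y * x = 1 -> subdomain_unit x.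
Proof.
move/(congr1 val); rewrite rmorphM rmorph1 /= => yx.
have x0 : val x != 0.
  by apply/eqP=> x0; move/eqP: yx; rewrite x0 mulr0 eq_sym oner_eq0.
have -> : subdomain_unit x = ((val x)^-1 \in S) by rewrite /subdomain_unit x0.
by rewrite -[_^-1]mul1r -yx mulfK // (valP y).
Qed.

Lemma subdomain_inv_out : {in [predC subdomain_unit], subdomain_inv =1 id}.
Proof.
move=> x; rewrite inE /= /subdomain_unit negb_and negbK => xu; apply: val_inj.
rewrite /subdomain_inv val_insubd; case: ifP => // xS; move: xu.
by rewrite xS orbF => /eqP x0; rewrite x0 invr0.
Qed.

HB.instance Definition _ := GRing.ComNzRing_hasMulInverse.Build subdomain
  subdomain_mulVx subdomain_unitP subdomain_inv_out.

Lemma subdomain_integral (x y : subdomain) : x * y = 0 -> (x == 0) || (y == 0).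
Proof.
by move/(congr1 val)/eqP; rewrite rmorphM rmorph0 mulf_eq0 -!(inj_eq val_inj).
Qed.

HB.instance Definition _ :=
  GRing.ComUnitRing_isIntegral.Build subdomain subdomain_integral.

End Subdomain.

Lemma subring_idomain (K : fieldType) (S : {pred K}) : subring_closed S ->
  exists (D : idomainType) (v : {rmorphism D -> K}),
    injective v /\ forall x, x \in S <-> exists y, v y = x.
Proof.
move=> S_subring.
pose S' : subringClosed K :=
  HB.pack_for (subringClosed K) S (GRing.isSubringClosed.Build K S S_subring).
exists (subdomain S'), val; split; first exact: val_inj.
move=> x; split=> [xS|[y <-]]; last exact: (valP y).
by exists (Subdomain (xS : x \in S')).
Qed.

(** * Divisibility in the localisation at the kernel of a morphism *)

Section LocalDivisibility.

Variables (R S : idomainType) (ev : {rmorphism R -> S}).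

(** Divisibility in the localisation of [R] at the kernel of [ev], with the denominator [d] cleared
    so that no fractions are formed. *)
Definition locdiv (q a : R) : Prop :=
  exists d h, ev d != 0 /\ d * a = q * h.

Definition locprime (q : R) : Prop :=
  [/\ q != 0, ev q = 0 &
    forall a b, locdiv q (a * b) -> locdiv q a \/ locdiv q b].

Lemma locdiv_mulr q a b : locdiv q a -> locdiv q (a * b).
Proof. by move=> [d [h [dn e]]]; exists d, (h * b); rewrite !mulrA e. Qed.

Lemma locdiv_ev0 q a : ev q = 0 -> locdiv q a -> ev a = 0.
Proof.
move=> q0 [d [h [dn /(congr1 ev)/eqP]]].
by rewrite !rmorphM q0 mul0r mulf_eq0 (negPf dn) => /eqP.
Qed.

Lemma locdiv_unitl q d a : ev d != 0 -> locdiv q (d * a) -> locdiv q a.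
Proof.
move=> dn [d' [h [dn' e]]]; exists (d' * d), h.
by rewrite rmorphM mulf_neq0 // -mulrA.
Qed.

Lemma locprimeX q a n : locprime q -> locdiv q (a ^+ n) -> locdiv q a.
Proof.
move=> [qn q0 qP]; elim: n => [/(locdiv_ev0 q0)/eqP|n IH].
  by rewrite expr0 rmorph1 oner_eq0.
by rewrite exprS => /qP[|/IH].
Qed.

End LocalDivisibility.


(** * Ideals of the perfect closure of the localisation *)

Section Radical.

Variables (R S : idomainType) (ev : {rmorphism R -> S}).
Variables (K : closedFieldType) (iota : {rmorphism R -> K}).
Hypothesis iota_inj : injective iota.
Hypothesis char2 : 2%N \in [pchar K].

(* [radical I] is the extension of the ideal [I] of [R] to the perfect closure
   of the localisation of [R] at the kernel of [ev], inside [K]. *)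
Definition radical_at (I : R -> Prop) (n : nat) (x : K) : Prop :=
  exists d a, [/\ ev d != 0, I a & iota d * x ^+ (2 ^ n) = iota a].

Definition radical (I : R -> Prop) (x : K) : Prop := exists n, radical_at I n x.

Definition ideal (I : R -> Prop) : Prop :=
  (forall a b, I a -> I b -> I (a + b)) /\ (forall a b, I a -> I (a * b)).

Definition vanishing (a : R) : Prop := ev a = 0.

Lemma ideal_vanishing : ideal vanishing.
Proof.
split=> a b; rewrite /vanishing ?rmorphD ?rmorphM => ->.
  by move=> ->; rewrite addr0.
by rewrite mul0r.
Qed.

Lemma ideal_total : ideal (fun=> True). Proof. by []. Qed.

Lemma ideal_locdiv q : ideal (locdiv ev q).
Proof.
split=> [a b [d [h [dn e]]] [d' [h' [dn' e']]]|a b]; last exact: locdiv_mulr.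
exists (d * d'), (h * d' + h' * d); split; first by rewrite rmorphM mulf_neq0.
transitivity (d * a * d' + d' * b * d); first by ring.
by rewrite e e'; ring.
Qed.

Lemma expr2nD n (x y : K) : (x + y) ^+ (2 ^ n) = x ^+ (2 ^ n) + y ^+ (2 ^ n).
Proof.
by rewrite exprDn_pchar // pnatX (pnatE _ (pcharf_prime char2)) char2.
Qed.

Lemma radical_at_le I n m x : ideal I -> (n <= m)%N ->
  radical_at I n x -> radical_at I m x.
Proof.
move=> [_ IM] /subnKC<- [d [a [dn Ia e]]].
exists (d ^+ (2 ^ (m - n))), (a ^+ (2 ^ (m - n))); split.
- by rewrite rmorphXn expf_neq0.
(* A positive power of [a] stays in [I]; the exponent is positive even when [m = n]. *)
- by case: (2 ^ _)%N (expn_gt0 2 (m - n)) => // k _; rewrite exprS; apply: IM.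
- by rewrite expnD exprM !rmorphXn /= -exprMn e.
Qed.

Lemma radical_sub (I I' : R -> Prop) x : (forall a, I a -> I' a) ->
  radical I x -> radical I' x.
Proof. by move=> sI [n [d [a [dn /sI Ia e]]]]; exists n, d, a. Qed.

Lemma radical_total I x : radical I x -> radical (fun=> True) x.
Proof. exact: radical_sub. Qed.

(** Sums and products can be computed once both elements have the same exponent and the same
    denominator. *)
Lemma radical_common I I' x y : ideal I -> ideal I' ->
  radical I x -> radical I' y -> exists n d a b,
  [/\ ev d != 0, I a, I' b, iota d * x ^+ (2 ^ n) = iota a
    & iota d * y ^+ (2 ^ n) = iota b].
Proof.
move=> idI idI' [n Ix] [m Iy].
have := radical_at_le idI' (leq_maxr n m) Iy.
have := radical_at_le idI (leq_maxl n m) Ix; move: (maxn n m) => k.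
move=> [d [a [dn Ia e]]] [d' [a' [dn' Ia' e']]].
exists k, (d * d'), (a * d'), (a' * d); split.
- by rewrite rmorphM mulf_neq0.
- by apply: idI.2.
- by apply: idI'.2.
- by rewrite !rmorphM /= -e; ring.
- by rewrite !rmorphM /= -e'; ring.
Qed.

Lemma radicalD I x y : ideal I -> radical I x -> radical I y ->
  radical I (x + y).
Proof.
move=> idI Ix Iy.
have [n [d [a [b [dn Ia Ib ea eb]]]]] := radical_common idI idI Ix Iy.
exists n, d, (a + b); split=> //; first exact: idI.1.
by rewrite expr2nD mulrDr ea eb rmorphD.
Qed.

Lemma radicalM I x y : ideal I -> radical I x -> radical (fun=> True) y ->
  radical I (x * y).
Proof.
move=> idI Ix Ty.
have [n [d [a [b [dn Ia _ ea eb]]]]] := radical_common idI ideal_total Ix Ty.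
exists n, (d * d), (a * b); split; [by rewrite rmorphM mulf_neq0|exact: idI.2|].
by rewrite exprMn !rmorphM /= -ea -eb; ring.
Qed.

Lemma radical_iota (I : R -> Prop) a : I a -> radical I (iota a).
Proof.
by exists 0%N, 1, a; rewrite !rmorph1 oner_neq0 expn0 expr1 mul1r.
Qed.

Local Notation J := (radical vanishing).

Lemma radical_vanishing_iota a : J (iota a) -> ev a = 0.
Proof.
move=> [n [d [b [dn b0 /esym]]]]; rewrite -rmorphXn -rmorphM => /iota_inj e.
move: b0; rewrite /vanishing e rmorphM rmorphXn => /eqP.
by rewrite mulf_eq0 (negPf dn) expf_eq0 => /andP[_ /eqP].
Qed.

Lemma radical_vanishing_n1 : ~ J 1.
Proof.
rewrite -(rmorph1 iota) => /radical_vanishing_iota/eqP.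
by rewrite rmorph1 oner_eq0.
Qed.

Lemma radical_locprime_iota q a : locprime ev q ->
  radical (locdiv ev q) (iota a) -> locdiv ev q a.
Proof.
move=> Pq [n [d [b [dn qb /esym]]]]; rewrite -rmorphXn -rmorphM => /iota_inj e.
by apply: (locprimeX Pq (n := 2 ^ n)); apply: (locdiv_unitl dn); rewrite -e.
Qed.

(** At a common exponent, [x] and [y] become fractions of elements of [R], and primality of [q] in
    the localisation applies to their numerators. *)
Lemma radical_prime q x y : locprime ev q ->
  radical (fun=> True) x -> radical (fun=> True) y ->
  radical (locdiv ev q) (x * y) ->
  radical (locdiv ev q) x \/ radical (locdiv ev q) y.
Proof.
move=> [_ q0 Pq] Tx Ty [m Pxy].
have [n [d [a [b [dn _ _ ea eb]]]]] :=
  radical_common ideal_total ideal_total Tx Ty.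
have [c [e [cn qe exy]]] := radical_at_le (ideal_locdiv q) (leq_maxl m n) Pxy.
have lift z r : iota d * z ^+ (2 ^ n) = iota r -> 
    iota (d ^+ (2 ^ (maxn m n - n))) * z ^+ (2 ^ maxn m n)
    = iota (r ^+ (2 ^ (maxn m n - n))).
  move=> h; rewrite -{2}(subnKC (leq_maxr m n)) expnD exprM !rmorphXn /=.
  by rewrite -exprMn h.
move: (lift _ _ ea) (lift _ _ eb); set k := (2 ^ _)%N => la lb.
have dkn : ev (d ^+ k) != 0 by rewrite rmorphXn expf_neq0.
have : locdiv ev q (c * (a ^+ k * b ^+ k)).
  have -> : c * (a ^+ k * b ^+ k) = e * (d ^+ k * d ^+ k).
    by apply: iota_inj; rewrite !rmorphM /= -la -lb -exy exprMn; ring.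
  exact: locdiv_mulr.
move/(locdiv_unitl cn)/Pq=> [] qd; [left|right]; exists (maxn m n);
  exists (d ^+ k).
  by exists (a ^+ k).
by exists (b ^+ k).
Qed.

Lemma pow_root n (x : K) : (0 < n)%N -> exists y, y ^+ n = x.
Proof.
move=> n0; have /closed_rootP[y] : size ('X^n - x%:P) != 1.
  by rewrite size_XnsubC // eqSS -lt0n.
by rewrite /root !hornerE subr_eq0 => /eqP; exists y.
Qed.

(* The divisor is a root of [q] of high enough order. *)
Lemma radical_common_divisor q (s : nat -> K) m : locprime ev q ->
  (forall i, (i < m)%N -> radical (locdiv ev q) (s i)) ->
  exists2 p, p != 0 /\ J p & forall i, (i < m)%N -> J (s i / p).
Proof.
move=> [qn q0 _] Ps; have idq := ideal_locdiv q.
have {Ps}[n Ps] : exists n, forall i, (i < m)%N ->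
    radical_at (locdiv ev q) n (s i).
  elim: m Ps => [|m IH] Ps; first by exists 0%N.
  have [n Pn] := IH (fun i lt_im => Ps i (leqW lt_im)).
  have [k Pk] := Ps m (ltnSn m); exists (maxn n k) => i.
  rewrite ltnS leq_eqVlt => /orP[/eqP->|/Pn].
    exact: radical_at_le (leq_maxr _ _) Pk.
  exact: radical_at_le (leq_maxl _ _).
(* With [n.+1] in place of [n], the power of [s i / p] is a fraction with numerator [q * h ^+ 2]: a
   factor [q] survives, so the quotient lies in [J]. *)
have [p ep] := pow_root (iota q) (expn_gt0 2 n.+1).
have iqn : iota q != 0 by rewrite -(rmorph0 iota) (inj_eq iota_inj).
have pn : p != 0.
  by apply: contraNneq iqn => p0; rewrite -ep p0 expr0n expn_eq0.
exists p.
  split=> //; exists n.+1, 1, q; split; rewrite ?rmorph1 ?oner_neq0 //.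
  by rewrite mul1r.
move=> i /Ps[d [a [dn [d' [h [dn' ea]]] e]]].
exists n.+1, ((d' * d) ^+ 2), (q * h ^+ 2); split.
- by rewrite rmorphXn rmorphM expf_neq0 // mulf_neq0.
- by rewrite /vanishing rmorphM q0 mul0r.
have e2 : iota (d' * d) * s i ^+ (2 ^ n) = iota (q * h).
  by rewrite rmorphM -mulrA e -rmorphM ea.
rewrite expr_div_n ep expnSr exprM mulrA rmorphXn -exprMn e2 !rmorphM /=.
by field.
Qed.

End Radical.

(** * Gauss's lemma modulo a prime ideal *)

Lemma prime_content (D : comNzRingType) (Q : D -> Prop) (f g : {poly D}) :
    (forall a b, Q a -> Q b -> Q (a + b)) -> (forall a b, Q a -> Q (a * b)) ->
    (forall a b, Q (a * b) -> Q a \/ Q b) ->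
    (forall i, Q (f * g)`_i) ->
  (forall i, Q f`_i) \/ (forall i, Q g`_i).
Proof.
move=> QD QM Qprime Qfg.
have Q0 : Q 0 by rewrite -(mulr0 (f * g)`_0); apply: QM.
have least (h : {poly D}) : (forall i, Q h`_i) \/
    exists i, ~ Q h`_i /\ forall j, (j < i)%N -> Q h`_j.
  have [allQ|] := EM (forall i, Q h`_i); [by left|].
  move=> /existsNP nQ; right.
  have exP : exists i, ~~ `[< Q h`_i >].
    by have [i nQi] := nQ; exists i; apply/asboolPn.
  case: (ex_minnP exP) => i /asboolPn nQi imin; exists i; split=> // j lt_ji.
  by apply: contrapT => /asboolPn/imin; rewrite leqNgt lt_ji.
have [|[i [nQi Qi]]] := least f; [by left|].
have [|[j [nQj Qj]]] := least g; [by right|].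
have lt_i : (i < (i + j).+1)%N by rewrite ltnS leq_addr.
have Qsum (P : pred 'I_(i + j).+1) (F : 'I_(i + j).+1 -> D) :
    (forall k, P k -> Q (F k)) -> Q (\sum_(k | P k) F k).
  by move=> QF; elim/big_ind: _.
(* With [i] and [j] the least indices of coefficients outside [Q], every other term of coefficient
   [i + j] of the product has a factor in [Q]. *)
have : Q (f`_i * g`_j).
  have := Qfg (i + j)%N; rewrite coefM (bigD1 (Ordinal lt_i)) //= addKn.
  set r := \sum_(_ | _) _ => Qr.
  rewrite -(addrK r (f`_i * g`_j)) -(mulrN1 r); apply: QD => //.
  apply: (QM); apply: Qsum => k; rewrite -val_eqE /= => ki.
  have [lt_ki|le_ik] := ltnP k i; first exact/QM/Qi.
  rewrite mulrC; apply/QM/Qj; rewrite ltn_subLR.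
    by rewrite ltn_add2r ltn_neqAle eq_sym ki.
  by rewrite -ltnS.
by case/Qprime.
Qed.

(** * The local ring [F_2 + J], its units and its lack of irreducibles *)

Section Residue.

Variables (R S : idomainType) (ev : {rmorphism R -> S}).
Variables (K : closedFieldType) (iota : {rmorphism R -> K}).
Hypothesis iota_inj : injective iota.
Hypothesis char2 : 2%N \in [pchar K].
Hypothesis locprime_divisor : forall a, a != 0 -> ev a = 0 ->
  exists2 q, locprime ev q & locdiv ev q a.

Local Notation J := (radical ev iota (vanishing ev)).
Local Notation V := (radical ev iota (fun=> True)).

(* In characteristic 2 this is the ring [F_2 + J]. *)
Definition residue_subring (x : K) : bool := `[< J x \/ J (1 + x) >].

Let JD x y : J x -> J y -> J (x + y).
Proof. exact/radicalD/ideal_vanishing. Qed.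

Let JM x y : J x -> V y -> J (x * y).
Proof. exact/radicalM/ideal_vanishing. Qed.

Let V1 : V 1.
Proof. by rewrite -(rmorph1 iota); apply: radical_iota. Qed.

Lemma radical_residue x : J x \/ J (1 + x) -> V x.
Proof.
case=> [/radical_total //|/radical_total V1x].
suff -> : x = (1 + x) + 1.
  by apply: radicalD => //; exact: ideal_total.
by rewrite addrAC (addrr_pchar2 char2) add0r.
Qed.

Lemma residue_subring_closed : subring_closed residue_subring.
Proof.
have J0 : J 0.
  by rewrite -(rmorph0 iota); apply: radical_iota; rewrite /vanishing rmorph0.
split.
- by apply/asboolP; right; rewrite (addrr_pchar2 char2).
- move=> x y /asboolP Dx /asboolP Dy; apply/asboolP.
  rewrite (oppr_pchar2 char2).
  case: Dx Dy => [Jx|Jx] [Jy|Jy].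
  + by left; apply: JD.
  + by right; rewrite addrCA; apply: JD.
  + by right; rewrite addrA; apply: JD.
  + left; have := JD Jx Jy.
    by rewrite addrACA (addrr_pchar2 char2) add0r.
- move=> x y /asboolP Dx /asboolP Dy; apply/asboolP.
  have Vx := radical_residue Dx; have Vy := radical_residue Dy.
  case: Dx => [Jx|Jx]; first by left; apply: JM.
  case: Dy => [Jy|Jy]; first by left; rewrite mulrC; apply: JM.
  right; have -> : 1 + x * y = (1 + x) * y + (1 + y).
    by rewrite -[LHS]addr0 -(addrr_pchar2 char2 y); ring.
  by apply: JD => //; apply: JM.
Qed.

Variables (D : idomainType) (v : {rmorphism D -> K}).
Hypothesis v_inj : injective v.
Hypothesis v_img : forall x, x \in residue_subring <-> exists y, v y = x.

Lemma residueP y : J (v y) \/ J (1 + v y).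
Proof. by apply/asboolP/(v_img (v y)); exists y. Qed.

Lemma residueV y : V (v y).
Proof. exact/radical_residue/residueP. Qed.

Lemma residue_lift x : J x -> exists y, v y = x.
Proof. by move=> Jx; apply/v_img/asboolP; left. Qed.

(** The inverse in [K] of an element congruent to 1 modulo [J] is again congruent to 1, hence lies
    in the ring. *)
Lemma residue_unit y : (y \is a GRing.unit) <-> ~ J (v y).
Proof.
split=> [yu Jy|nJy].
  apply: (radical_vanishing_n1 (ev := ev) iota_inj).
  by rewrite -(rmorph1 v) -(divrr yu) rmorphM; apply: JM => //; apply: residueV.
have [//|[n [d [a [dn a0 e]]]]] := residueP y.
have y0 : v y != 0.
  apply: contra_not_neq nJy => ->; rewrite -(rmorph0 iota).
  by apply: radical_iota; rewrite /vanishing rmorph0.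
have : J (1 + (v y)^-1).
  (* From [d * (1 + y) ^+ (2 ^ n) = a] comes [d * y ^+ (2 ^ n) = d + a], so that the power of
     [1 + y^-1] is [a / (d + a)]. *)
  exists n, (d + a), a; split=> //; first by rewrite rmorphD a0 addr0.
  have ey : iota (d + a) = iota d * v y ^+ (2 ^ n).
    rewrite rmorphD -e expr2nD // expr1n mulrDr mulr1 addrA.
    by rewrite (addrr_pchar2 char2) add0r.
  have -> : 1 + (v y)^-1 = (1 + v y) / v y.
    by rewrite mulrDl mul1r divff // addrC.
  rewrite ey expr_div_n -e.
  by move: (expf_neq0 (2 ^ n) y0) => yn; field.
move=> Jy; have [z ez] : exists z, v z = (v y)^-1.
  by apply/v_img/asboolP; right.
apply/unitrPr; exists z; apply: v_inj.
by rewrite rmorphM ez rmorph1 divff.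
Qed.

Lemma residue_IDF : IDF_domain D.
Proof.
move=> a _; exists [::] => p [p0 pu irr] _.
have Jp : J (v p) by apply: contrapT => /residue_unit; rewrite (negPf pu).
(* A square root of an element of [J] is in [J], with exponent one higher, so [p] is a product of
   two nonunits. *)
have [s es] := pow_root (v p) (isT : 0 < 2)%N.
have Js : J s.
  have [n [d [b [dn b0 e]]]] := Jp; exists n.+1, d, b; split=> //.
  by rewrite expnS exprM es.
have [w ew] := residue_lift Js; subst s.
have nu : w \isn't a GRing.unit by apply/negP => /residue_unit.
have /irr[] : p = w * w by apply: v_inj; rewrite -es rmorphM.
all: by rewrite (negPf nu).
Qed.


(** * Primitive polynomials and the GL property *)

Lemma primitive_coef_dvd (f : {poly D}) (a : D) :
  primitive_poly f -> (forall i, exists c, f`_i = c * a) -> a \is a GRing.unit.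
Proof.
move=> [_ fP] fa; apply: contrapT => au; apply: (fP a).
  by exists 1 => -[c /esym ca]; apply/au/unitrPr; exists c; rewrite mulrC.
move=> _ [c ->].
elim/big_ind: _ => [|x y [s ->] [t ->]|i _]; first by exists 0; rewrite mul0r.
  by exists (s + t); rewrite mulrDl.
by have [s ->] := fa i; exists (c i * s); rewrite mulrA.
Qed.

(** Some power of [v a] is a fraction whose numerator vanishes under [ev]; any local prime dividing
    that numerator will do. *)
Lemma residue_locprime a : a != 0 -> a \isn't a GRing.unit ->
  exists2 q, locprime ev q & radical ev iota (locdiv ev q) (v a).
Proof.
move=> a0 au.
have [n [d [b [dn b0 e]]]] : J (v a).
  by apply: contrapT => /residue_unit; rewrite (negPf au).
have bn : b != 0.
  apply/eqP => b00; move/eqP: e; rewrite b00 rmorph0 mulf_eq0 expf_eq0.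
  rewrite -(rmorph0 iota) (inj_eq iota_inj) rmorph0 -(rmorph0 v) (inj_eq v_inj).
  by rewrite (negPf a0) andbF orbF => /eqP d0; rewrite d0 rmorph0 eqxx in dn.
have [q Pq qb] := locprime_divisor bn b0.
by exists q => //; exists n, d, b.
Qed.

Lemma residue_GL : GL_domain D.
Proof.
move=> f g Pf Pg; have fg0 : f * g != 0 by rewrite mulf_neq0 ?Pf.1 ?Pg.1.
split=> // a [y ya] Ia.
have au : a \isn't a GRing.unit.
  by apply/negP=> au; apply: ya; exists (y / a); rewrite divrK.
have fga i : exists c, (f * g)`_i = c * a.
  have [lt_i|/(nth_default 0) ->] := ltnP i (size (f * g)); last first.
    by exists 0; rewrite mul0r.
  (* The indicator of [i] exhibits a single coefficient as an element of the content ideal. *)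
  apply: Ia; exists (fun j => (j == i)%:R).
  rewrite (bigD1 (Ordinal lt_i)) //= eqxx mul1r big1 ?addr0 // => j.
  by rewrite -val_eqE /= => /negPf ->; rewrite mul0r.
have a0 : a != 0.
  apply: contraNneq fg0 => a0; apply/eqP/polyP=> i.
  by have [c ->] := fga i; rewrite a0 mulr0 coef0.
have [q Pq qa] := residue_locprime a0 au; have idq := ideal_locdiv ev q.
(* If all coefficients lie in the radical of [q], they share a root of [q] as a common divisor,
   which is in [J] and so not a unit. *)
have no_content h : primitive_poly h ->
    (forall i, radical ev iota (locdiv ev q) (v h`_i)) -> False.
  move=> Ph Qh.
  have [p [p0 Jp] hp] := radical_common_divisor iota_inj Pq
    (fun i (_ : (i < size h)%N) => Qh i).
  have [w ew] := residue_lift Jp; subst p.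
  have /residue_unit [] // : w \is a GRing.unit.
  apply: (primitive_coef_dvd Ph) => i.
  have [/hp/residue_lift[c ec]|/(nth_default 0) ->] := ltnP i (size h).
    exists c; apply: v_inj; rewrite rmorphM ec divfK //.
  by exists 0; rewrite mul0r.
have [||||Qf|Qg] := @prime_content D
    (fun x => radical ev iota (locdiv ev q) (v x)) f g; last 2 first.
- exact: no_content Pf Qf.
- exact: no_content Pg Qg.
- by move=> x y' Qx Qy; rewrite rmorphD; apply: radicalD.
- by move=> x y' Qx; rewrite rmorphM; apply: radicalM => //; apply: residueV.
- by move=> x y'; rewrite rmorphM; apply: radical_prime => //; apply: residueV.
move=> i; have [c ->] := fga i; rewrite rmorphM mulrC.
by apply: radicalM => //; apply: residueV.
Qed.

(** * Infinitely many irreducible divisors of one polynomial *)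

Variables (x y : R) (l : nat -> R).
Hypotheses (x_neq0 : x != 0) (y_neq0 : y != 0).
Hypotheses (ev_x : ev x = 0) (ev_y : ev y = 0).
Hypothesis xy_coprime : forall q,
  locprime ev q -> locdiv ev q x -> locdiv ev q y -> False.
Hypothesis l_neq0 : forall i, ev (l i) != 0.
Hypothesis l_inj : injective (ev \o l).

Let iota_neq0 a : a != 0 -> iota a != 0.
Proof. by rewrite -(rmorph0 iota) (inj_eq iota_inj). Qed.

Let lin_lift a c : ev a = 0 -> exists w, v w = iota (c * a).
Proof.
move=> a0; apply/residue_lift/radical_iota.
by rewrite /vanishing rmorphM a0 mulr0.
Qed.

(** A nonunit [c] would lie in the radical of a local prime, which would then divide [l i * x] and
    [l i * y], hence [x] and [y], as [l i] is a local unit. *)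
Lemma factor_const_unit i (A B c : D) (h : {poly D}) :
  v A = iota (l i * x) -> v B = iota (l i * y) ->
  A%:P + B *: 'X = c%:P * h -> c \is a GRing.unit.
Proof.
move=> eA eB e.
have cA : A = c * h`_0.
  by rewrite -coefCM -e coefD coefC coefZ coefX mulr0 addr0.
have cB : B = c * h`_1.
  by rewrite -coefCM -e coefD coefC coefZ coefX mulr1 add0r.
have ln : l i != 0 by apply: contraNneq (l_neq0 i) => ->; rewrite rmorph0.
have c0 : c != 0.
  apply: contraTneq (iota_neq0 (mulf_neq0 ln x_neq0)) => c0.
  by rewrite -eA cA c0 mul0r rmorph0 eqxx.
apply: contrapT => /negP cu; have [q Pq qc] := residue_locprime c0 cu.
have Qdiv a w : v (c * w) = iota (l i * a) -> locdiv ev q a.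
  move=> ea; apply: (locdiv_unitl (l_neq0 i)).
  apply: (radical_locprime_iota iota_inj Pq); rewrite -ea rmorphM.
  by apply: radicalM (residueV w) => //; apply: ideal_locdiv.
by apply: (xy_coprime Pq); [apply: (Qdiv _ h`_0)|apply: (Qdiv _ h`_1)];
  rewrite -?cA -?cB.
Qed.

(** In any factorisation of a polynomial of degree one over a domain, one factor is constant, hence
    a unit by [factor_const_unit]. *)
Lemma linear_irreducible i (A B : D) :
  v A = iota (l i * x) -> v B = iota (l i * y) ->
  irreducible_elt (A%:P + B *: 'X).
Proof.
move=> eA eB; set g := _ + _.
have ln : l i != 0 by apply: contraNneq (l_neq0 i) => ->; rewrite rmorph0.
have B0 : B != 0.
  apply: contraTneq (iota_neq0 (mulf_neq0 ln y_neq0)) => B0.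
  by rewrite -eB B0 rmorph0 eqxx.
have sg : size g = 2%N.
  rewrite /g addrC size_polyDl size_scale ?size_polyX //.
  exact: leq_ltn_trans (size_polyC_leq1 _) _.
have g0 : g != 0 by rewrite -size_poly_eq0 sg.
split=> //; first by rewrite poly_unitE sg.
move=> a b e; move: (g0); rewrite e mulf_eq0 negb_or => /andP[a0 b0].
have unitC c h : g = c * h -> (size c <= 1)%N -> c \is a GRing.unit.
  move=> eg /size1_polyC ec; rewrite ec in eg *.
  by rewrite rmorph_unit // (factor_const_unit eA eB eg).
have sab : ((size a + size b).-1 = 2)%N by rewrite -size_mul // -e.
have [sa|sa] := leqP (size a) 1; first by left; apply: (unitC a b).
right; apply: (unitC b a); first by rewrite e mulrC.
move: sab sa; case: (size a) => [|[|k]] //; case: (size b) => [|[|m]] //.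
by rewrite !addSn !addnS /=.
Qed.

(** Units of [{poly D}] are constants congruent to 1 modulo [J], so comparing constant coefficients
    gives [l i] and [l j] the same residue. *)
Lemma linear_nonassociate i j (A B A' B' : D) (q : {poly D}) :
  v A = iota (l i * x) -> v A' = iota (l j * x) ->
  associates q (A%:P + B *: 'X) -> associates q (A'%:P + B' *: 'X) -> i = j.
Proof.
move=> eA eA' [u uu eu] [u' uu' eu']; apply: l_inj.
have cst w : w \is a GRing.unit -> exists2 c : D, c \is a GRing.unit & w = c%:P.
  rewrite poly_unitE => /andP[/eqP sw wu]; exists w`_0 => //.
  by apply: size1_polyC; rewrite sw.
have [c cu ec] := cst _ uu; have [c' cu' ec'] := cst _ uu'.
have eAA : c' * A = c * A'.
  have : c'%:P * (A%:P + B *: 'X) = c%:P * (A'%:P + B' *: 'X).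
    by rewrite eu eu' -ec -ec' mulrCA.
  move/(congr1 (fun p : {poly D} => p`_0)).
  by rewrite !coefCM !coefD !coefC !coefZ !coefX !mulr0 !addr0.
have Jc w : w \is a GRing.unit -> J (1 + v w).
  by move=> /residue_unit nJ; case: (residueP w).
have el : v c' * iota (l i) = v c * iota (l j).
  apply: (mulIf (iota_neq0 x_neq0)); rewrite -!mulrA -!rmorphM /= -eA -eA'.
  by rewrite -!rmorphM eAA.
have Jl : J (iota (l i + l j)).
  have -> : iota (l i + l j) =
      (1 + v c') * iota (l i) + (1 + v c) * iota (l j).
    rewrite !mulrDl !mul1r el addrACA (addrr_pchar2 char2) addr0.
    by rewrite rmorphD.
  by apply: JD; apply: JM (radical_iota _ _ _) => //; apply: Jc.
have /= := radical_vanishing_iota iota_inj Jl; rewrite rmorphD => e.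
have : ev (l i) = - ev (l j) by apply/eqP; rewrite -addr_eq0 e.
move=> ->; rewrite /= -rmorphN; congr (ev _); apply: iota_inj.
by rewrite rmorphN (oppr_pchar2 char2).
Qed.

Lemma residue_poly_not_IDF : ~ IDF_domain {poly D}.
Proof.
move=> IDF.
have [X1 eX1] := lin_lift 1 ev_x; have [Y1 eY1] := lin_lift 1 ev_y.
rewrite !mul1r in eX1 eY1.
have ln i : l i != 0 by apply: contraNneq (l_neq0 i) => ->; rewrite rmorph0.
have X10 : X1 != 0.
  apply: contraTneq (iota_neq0 x_neq0) => X10.
  by rewrite -eX1 X10 rmorph0 eqxx.
have g0 : X1%:P + Y1 *: 'X != 0.
  apply/negP=> /eqP/(congr1 (fun p : {poly D} => p`_0)).
  by rewrite coefD coefC coefZ coefX mulr0 addr0 coef0 => /eqP; apply/negP.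
have F0 : X1%:P * (X1%:P + Y1 *: 'X) != 0 by rewrite mulf_neq0 // polyC_eq0.
have [s sP] := IDF _ F0.
have lin i : exists AB : D * D,
    v AB.1 = iota (l i * x) /\ v AB.2 = iota (l i * y).
  have [A eA] := lin_lift (l i) ev_x; have [B eB] := lin_lift (l i) ev_y.
  by exists (A, B).
have [AB ABP] := choice lin.
have assoc i : exists q, q \in s /\
    associates q ((AB i).1%:P + (AB i).2 *: 'X).
  have [eA eB] := ABP i; have irr := linear_irreducible eA eB.
  (* The extra factor [X1] of the polynomial is there for this cofactor: [x / l i] is in [J],
     whereas the inverse of [l i] is in general not in the ring. *)
  have [C eC] : exists C, v C = iota x / iota (l i).
    apply: residue_lift; exists 0%N, (l i), x; split=> //.
    by rewrite expn0 expr1 mulrCA divff ?mulr1 // iota_neq0.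
  have div : divides ((AB i).1%:P + (AB i).2 *: 'X)
      (X1%:P * (X1%:P + Y1 *: 'X)).
    have li := iota_neq0 (ln i).
    exists C%:P; rewrite !mulrDr -!polyCM -!scalerAr -!mul_polyC !mulrA -!polyCM.
    congr (_%:P + _%:P * _); apply: v_inj;
    by rewrite !rmorphM eC ?eA ?eB eX1 ?eY1 rmorphM; field.
  by have [q qs qa] := sP _ irr div; exists q.
have [h hP] := choice assoc.
(* Pigeonhole: [size s + 1] of the linear divisors, pairwise nonassociate, would need distinct
   representatives in [s]. *)
have hlt (i : 'I_(size s).+1) : (index (h i) s < size s)%N.
  by rewrite index_mem; have [] := hP i.
have /leq_card : injective (fun i => Ordinal (hlt i)).
  move=> i j /(congr1 val)/= /(congr1 (nth 0 s)).
  have [hi ai] := hP i; have [hj aj] := hP j.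
  rewrite !nth_index // => eh; rewrite -eh in aj; apply: val_inj => /=.
  have [eA _] := ABP i; have [eA' _] := ABP j.
  exact: linear_nonassociate eA eA' ai aj.
by rewrite !card_ord ltnn.
Qed.

End Residue.

(** * Primes of the local ring of the plane at the origin *)

Section Plane.

Variable E : fieldType.
Local Notation R := {poly {poly E}}.
Implicit Types a b q : R.


(** [R] is read as [E[X][Y]]: the first coordinate is the constant ['X%:P], the second is ['X]. This
    map is reduction modulo the first. *)
Definition atX0 : R -> {poly E} := map_poly (horner_eval 0).
HB.instance Definition _ := GRing.RMorphism.on atX0.

Definition origin : R -> E := horner_eval 0 \o atX0.
HB.instance Definition _ := GRing.RMorphism.on origin.

Lemma atX0M : {morph atX0 : a b / a * b}. Proof. exact: rmorphM. Qed.
Lemma originM : {morph origin : a b / a * b}. Proof. exact: rmorphM. Qed.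

Local Notation X := ('X%:P : R).

Lemma atX0C c : atX0 c%:P = c.[0]%:P.
Proof. by rewrite /atX0 map_polyC. Qed.

Lemma atX0X : atX0 X = 0.
Proof. by rewrite atX0C hornerX polyC0. Qed.

Lemma atX0_eq0 a : atX0 a = 0 -> exists b, a = X * b.
Proof.
move=> a0; exists (map_poly (fun c : {poly E} => c %/ 'X) a).
apply/polyP=> i; rewrite coefCM coef_map_id0 ?div0p // mulrC Pdiv.Field.divpK //.
have /polyP/(_ i) := a0; rewrite coef0 coef_map /= /horner_eval => ai0.
have -> : 'X = 'X - 0%:P :> {poly E} by rewrite polyC0 subr0.
by rewrite dvdp_XsubCl; apply/rootP.
Qed.

Lemma originX : origin X = 0.
Proof. by rewrite /origin /= atX0X /horner_eval horner0. Qed.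

Lemma origin_neq0 a : origin a != 0 -> atX0 a != 0.
Proof.
by apply: contraNneq => a0; rewrite /origin /= a0 /horner_eval horner0.
Qed.

Lemma X_neq0 : X != 0.
Proof. by rewrite polyC_eq0 polyX_eq0. Qed.

(* [X] is prime, being the kernel of a morphism to a domain. *)
Lemma X_factor k : forall a b c : R, ('X^k : {poly E})%:P * a = b * c ->
  exists b' c', [/\ a = b' * c', size b' = size b & size c' = size c].
Proof.
elim: k => [|k IH] a b c; first by rewrite expr0 mul1r => ->; exists b, c.
rewrite exprS polyCM -mulrA => e.
have /eqP: atX0 (b * c) = 0 by rewrite -e atX0M atX0X mul0r.
have sX p : size (X * p) = size p by rewrite mul_polyC size_scale ?polyX_eq0.
rewrite atX0M mulf_eq0 => /orP[]/eqP/atX0_eq0[h eh].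
  have /IH[b' [c' [-> sb sc]]] : ('X^k : {poly E})%:P * a = h * c.
    by apply: (mulfI X_neq0); rewrite e eh mulrA.
  by exists b', c'; rewrite eh sX.
have /IH[b' [c' [-> sb sc]]] : ('X^k : {poly E})%:P * a = b * h.
  by apply: (mulfI X_neq0); rewrite e eh mulrCA.
by exists b', c'; rewrite eh sX.
Qed.

Lemma X_factor_nondiv k (a b c : R) :
  atX0 c != 0 -> ('X^k : {poly E})%:P * a = b * c ->
  exists b', a = b' * c.
Proof.
move=> c0; elim: k b => [|k IH] b; first by rewrite expr0 mul1r => ->; exists b.
rewrite exprS polyCM -mulrA => e.
have /eqP: atX0 (b * c) = 0 by rewrite -e atX0M atX0X mul0r.
rewrite atX0M mulf_eq0 (negPf c0) orbF => /eqP/atX0_eq0[h eh].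
by apply: (IH h); apply: (mulfI X_neq0); rewrite e eh mulrA.
Qed.

(** Up to a local unit, every denominator from [E[X]] is a power of [X]. *)
Lemma split_X (e : {poly E}) : e != 0 ->
  exists k d, e = 'X^k * d /\ origin d%:P != 0.
Proof.
move=> en; have [k [d]] := multiplicity_XsubC e 0.
rewrite en /= subr0 => dn ->.
exists k, d; rewrite mulrC; split=> //.
by rewrite /origin /= atX0C /horner_eval hornerC.
Qed.

Lemma locprime_X : locprime origin X.
Proof.
split; [exact: X_neq0 | exact: originX |].
move=> a b [d [h [dn /(congr1 atX0)/eqP]]].
rewrite !atX0M atX0X mul0r !mulf_eq0 (negPf (origin_neq0 dn)) /=.
by case/orP=> /eqP/atX0_eq0[g ->]; [left|right]; exists 1, g;
  rewrite rmorph1 oner_neq0 mul1r.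
Qed.

(* Division over the fraction field of [E[X]] becomes local division once the
   powers of [X] in the denominator are cancelled. *)
Lemma dvdp_locdiv q a : atX0 q != 0 -> q %| a -> locdiv origin q a.
Proof.
move=> q0 /dvdpP[[e h] /= en].
have [k [d [-> dn]]] := split_X en.
rewrite -mul_polyC polyCM -mulrA => /(X_factor_nondiv q0)[g eg].
by exists d%:P, g; rewrite eg mulrC.
Qed.

(** Here [%|] and [irreducible_poly] refer to division up to nonzero factors in [E[X]], that is over
    [E(X)], where irreducibles are prime; [dvdp_locdiv] brings this back to the local ring. *)
Lemma locprime_irred q : atX0 q != 0 -> origin q = 0 ->
  irreducible_poly q -> locprime origin q.
Proof.
move=> q0 oq [sq irr].
have qn : q != 0 by rewrite -size_poly_gt0 (ltn_trans _ sq).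
have prime_q a b : q %| a * b -> q %| a \/ q %| b.
  have [|/coprimepPn] := boolP (coprimep q a).
    by move/Gauss_dvdpr=> ->; right.
  case/(_ qn)=> d /andP[]; rewrite dvdp_gcd => /andP[dq da] d1; left.
  have sd : size d != 1 by rewrite size_poly_eq1.
  by rewrite -(eqp_dvdl _ (irr d sd dq)).
split=> // a b [d [h [dn e]]].
have: q %| d * (a * b) by rewrite e dvdp_mulr.
case/prime_q=> [qd|/prime_q[]]; last 2 first.
- by left; apply: dvdp_locdiv.
- by right; apply: dvdp_locdiv.
by have := locdiv_ev0 oq (dvdp_locdiv q0 qd) => /eqP; rewrite (negPf dn).
Qed.

(** Induction on the degree in [Y]: unless [X] divides [a] or [a] is irreducible over [E(X)], a
    local unit times [a] splits into factors of smaller degree, one of which vanishes at the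
    origin. *)
Lemma locprime_divisor a : a != 0 -> origin a = 0 ->
  exists2 q, locprime origin q & locdiv origin q a.
Proof.
have [n] := ubnP (size a); elim: n a => // n IH a; rewrite ltnS => sa an oa.
have [/atX0_eq0[b ->]|a0] := eqVneq (atX0 a) 0.
  exists X; first exact: locprime_X.
  by exists 1, b; rewrite rmorph1 oner_neq0 mul1r.
have [irr|nirr] := EM (irreducible_poly a).
  by exists a; [exact: locprime_irred | apply: dvdp_locdiv].
have sa1 : (1 < size a)%N.
  rewrite ltnNge; apply/negP=> /size1_polyC ea; move: oa a0.
  rewrite ea /origin /= atX0C /horner_eval hornerC => ->.
  by rewrite polyC0 eqxx.
have [p [sp pa npa]] : exists p : R, [/\ size p != 1, p %| a & ~~ (p %= a)].
  apply: contrapT => np; apply: nirr; split=> // p sp pa.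
  by apply: contrapT => npa; apply: np; exists p; split=> //; apply/negP.
have pn := dvdpN0 pa an.
(* The powers of [X] in the denominator are cancelled against the two factors without changing their
   degrees. *)
case/dvdpP: pa (pa) => -[e h] /= en; have [k [d [-> dn]]] := split_X en.
rewrite -mul_polyC polyCM -mulrA => /X_factor[h' [p' [e' sh sp']]] pa.
have dn0 : d%:P != 0 :> R by apply: contraNneq dn => ->; rewrite rmorph0.
have hpn : h' * p' != 0 by rewrite -e' mulf_neq0.
move: (hpn); rewrite mulf_eq0 negb_or => /andP[h'n p'n].
have sE : (size a = (size h' + size p').-1)%N.
  by rewrite -size_mul // -e' mul_polyC size_scale // -(polyC_eq0 d).
have sp1 : (1 < size p')%N.
  by rewrite sp' ltn_neqAle eq_sym sp size_poly_gt0.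
have sa' : (size p' < size a)%N.
  by rewrite sp' ltn_neqAle dvdp_size_eqp // npa dvdp_leq.
have sh' : (size h' < size a)%N.
  rewrite sE; move: sp1; case: (size p') => // -[|m] // _.
  by rewrite addnS /= addnS ltnS leq_addr.
have /eqP : origin (h' * p') = 0 by rewrite -e' originM oa mulr0.
rewrite originM mulf_eq0 => /orP[]/eqP o0.
  have [q Pq qd] := IH h' (leq_trans sh' sa) h'n o0; exists q => //.
  by apply: (locdiv_unitl dn); rewrite e'; apply: locdiv_mulr.
have [q Pq qd] := IH p' (leq_trans sa' sa) p'n o0; exists q => //.
by apply: (locdiv_unitl dn); rewrite e' mulrC; apply: locdiv_mulr.
Qed.

(** If [d * X = q * h], then [X] divides [q] or [h]. In the first case [X] would locally divide [Y];
    in the second [q] divides [d], which does not vanish at the origin. *)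
Lemma locprime_XY q : locprime origin q -> locdiv origin q X ->
  locdiv origin q 'X -> False.
Proof.
move=> [_ oq _] [d [h [dn /esym e]]] qY.
have /eqP: atX0 (q * h) = 0 by rewrite e atX0M atX0X mulr0.
rewrite atX0M mulf_eq0 => /orP[]/eqP/atX0_eq0[g eg].
  have [d' [h' [/origin_neq0/negPf d'n /(congr1 atX0)/eqP]]] := qY.
  rewrite eg -mulrA 2!atX0M atX0X mul0r mulf_eq0 d'n.
  by rewrite /atX0 map_polyX polyX_eq0.
case/negP: dn; suff -> : d = q * g by rewrite /= originM oq mul0r.
by apply: (mulfI X_neq0); rewrite mulrC -e eg mulrCA.
Qed.

End Plane.

(** * Countability and algebraically closed extensions *)

Definition encodable (T : Type) : Prop := exists c : T -> nat, injective c.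

Lemma encodable_poly (R : nzRingType) : encodable R -> encodable {poly R}.
Proof.
move=> [c c_inj]; exists (fun p : {poly R} => pickle (map c p)) => p q.
by move/(pcan_inj pickleK)/(inj_map c_inj)/val_inj.
Qed.

Lemma encodable_fraction (R : idomainType) :
  encodable R -> encodable {fraction R}.
Proof.
move=> [c c_inj].
exists (fun x : {fraction R} =>
  pickle (c (frac (repr x)).1, c (frac (repr x)).2)).
move=> x y /(pcan_inj pickleK)[/c_inj e1 /c_inj e2].
apply: (can_inj (@reprK _ {fraction R})); apply: val_inj.
exact: injective_projections.
Qed.

Lemma closed_extension (R : idomainType) : encodable R ->
  exists (K : closedFieldType) (iota : {rmorphism R -> K}), injective iota.
Proof.
move=> /encodable_fraction[c c_inj].
(* A partial inverse of the encoding, obtained by choice, provides the countable structure that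
   [countable_algebraic_closure] takes. *)
pose d n : option {fraction R} :=
  if pselect (exists x, c x = n) is left h then Some (projT1 (cid h)) else None.
have cd : pcancel c d.
  move=> x; rewrite /d; case: pselect => [h|[]]; last by exists x.
  by congr Some; apply: c_inj; exact: projT2 (cid h).
pose F : countFieldType :=
  HB.pack_for countFieldType {fraction R} (isCountable.Build {fraction R} cd).
have [K [f _]] := countable_algebraic_closure F.
exists K, ((f : {rmorphism {fraction R} -> K}) \o @tofrac R) => a b.
by move=> /fmorph_inj/eqP; rewrite tofrac_eq => /eqP.
Qed.

(** * The counterexample *)

Lemma plane_counterexample (E : fieldType) (t : nat -> E) :
    encodable E -> 2%N \in [pchar E] -> injective t -> (forall i, t i != 0) ->
  exists D : idomainType,
    [/\ GL_domain D, IDF_domain D & ~ IDF_domain {poly D}].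
Proof.
move=> encE char2E t_inj t_neq0.
pose R : idomainType := {poly {poly E}}.
pose ev : {rmorphism R -> E} := @origin E.
have [K [iota iota_inj]] : exists (K : closedFieldType)
    (iota : {rmorphism R -> K}), injective iota.
  exact/closed_extension/encodable_poly/encodable_poly.
have char2 : 2%N \in [pchar K].
  by apply: (rmorph_pchar iota); rewrite !pchar_poly.
have S_closed : subring_closed (residue_subring ev iota).
  exact: residue_subring_closed char2.
have [D [v [v_inj v_img]]] := subring_idomain S_closed.
exists D; split.
- exact: (residue_GL iota_inj char2 (@locprime_divisor E) v_inj v_img).
- exact: (residue_IDF iota_inj char2 v_inj v_img).
pose l i : {poly {poly E}} := (t i)%:P%:P.
have origin_l i : origin (l i) = t i.
  by rewrite /origin /= atX0C /horner_eval !hornerC.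
have Y_neq0 : ('X : {poly {poly E}}) != 0 by rewrite polyX_eq0.
have originY : origin ('X : {poly {poly E}}) = 0.
  by rewrite /origin /= /atX0 map_polyX /horner_eval hornerX.
apply: (residue_poly_not_IDF iota_inj char2 (@locprime_divisor E) v_inj v_img
  (X_neq0 E) Y_neq0 (originX E) originY (@locprime_XY E) (l := l)) => [i|i j].
  by rewrite /= origin_l.
by rewrite /= !origin_l => /t_inj.
Qed.

Theorem theorem4p2 :
  exists D : idomainType,
    [/\ GL_domain D, IDF_domain D & ~ IDF_domain {poly D}].
Proof.
(* The field of rational functions over [F_2] is countable, of characteristic 2, and infinite
   through the powers of its variable. *)
apply: (@plane_counterexample {fraction {poly 'F_2}}
  (fun i => @tofrac {poly 'F_2} ('X ^+ i))).
- apply/encodable_fraction/encodable_poly; exists pickle.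
  exact: pcan_inj pickleK.
- by apply: (rmorph_pchar (@tofrac {poly 'F_2})); rewrite pchar_poly pchar_Fp.
- move=> i j /eqP; rewrite tofrac_eq => /eqP.
  by move/(congr1 (fun p : {poly 'F_2} => size p)); rewrite !size_polyXn => -[].
by move=> i; rewrite tofrac_eq0 expf_neq0 ?polyX_eq0.
Qed.
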